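(* Let $n\ge 1$. Every $2$-coloring of the edges of the ordered complete graph on $[3n-1]$ contains a monochromatic non-separated matching with $n$ edges.
   Context: The ordered complete graph on $[m]=\{1,\dots,m\}$ is the complete graph with vertex set $[m]$, taken with its natural ordering; edges are written $(i,j)$ with $i<j$. A $2$-coloring assigns one of two colors to each edge. Two edges are independent if they share no vertex; independent edges $(a,b)$ and $(c,d)$ are separated if $a<b<c<d$ or $c<d<a<b$. A matching is a set of pairwise independent edges; it is non-separated if no two of its edges are separated, and monochromatic if all its edges have the same color. *)

(* Defs.v *)
From mathcomp Require Import all_boot.
Set Implicit Arguments.
Unset Strict Implicit.
Unset Printing Implicit Defensive.

(* The vertex i of [m] = {1, ..., m} is the ordinal of value i - 1, so the
   natural order of [m] is the order of 'I_m. *)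
Definition edge (m : nat) := {e : 'I_m * 'I_m | e.1 < e.2}.

Definition src (m : nat) (e : edge m) : 'I_m := (val e).1.
Definition tgt (m : nat) (e : edge m) : 'I_m := (val e).2.

Definition ends (m : nat) (e : edge m) : {set 'I_m} := [set src e; tgt e].

Definition independent (m : nat) (e f : edge m) : bool :=
  [disjoint ends e & ends f].

(* The chain conditions already force e and f to be independent. *)
Definition separated (m : nat) (e f : edge m) : bool :=
  [&& src e < tgt e, tgt e < src f & src f < tgt f]
  || [&& src f < tgt f, tgt f < src e & src e < tgt e].

Definition matching (m : nat) (M : {set edge m}) : Prop :=
  {in M &, forall e f, e != f -> independent e f}.

Definition non_separated (m : nat) (M : {set edge m}) : Prop :=
  {in M &, forall e f, ~~ separated e f}.

Definition monochromatic (m : nat) (c : edge m -> bool) (M : {set edge m}) :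
  Prop := exists k : bool, {in M, forall e, c e = k}.

(* Main.v *)
Require Import Defs.
From mathcomp Require Import all_boot.
From mathcomp Require Import zify.
Set Implicit Arguments.
Unset Strict Implicit.
Unset Printing Implicit Defensive.

(** Intervals that pairwise intersect share a cut point, so the matchings sought
    are the bipartite matchings across a cut t, between L = {i < t} and its
    complement R.  If no cut has a monochromatic n-matching, König's theorem
    gives at each cut and for each color k a cover (X k, Y k) of fewer than n
    vertices.  The union of the two covers meets every edge across the cut,
    hence contains L or R.  It cannot contain L for large t; at the last t
    where it does, it contains R at t + 1.  Comparing the two cuts leaves
    nonempty sets D before t and C after t + 1, with at least 2n vertices in
    total, such that all edges between D and C have the same color k; then D
    lies in X k at cut t and C in Y k at cut t + 1, each of fewer than n
    elements. *)

(** * König's theorem for bipartite graphs, by uncrossing vertex covers *)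

Definition bicover (A B : finType) (E : {set A * B}) (q : {set A} * {set B}) :=
  [forall p in E, (p.1 \in q.1) || (p.2 \in q.2)].

Lemma bicoverP {A B : finType} {E : {set A * B}} {q : {set A} * {set B}} :
  reflect (forall a b, (a, b) \in E -> a \in q.1 \/ b \in q.2) (bicover E q).
Proof.
apply: (iffP forall_inP) => [h a b /h /orP // | h [a b] /h abq].
exact/orP.
Qed.

(** An edge of both graphs with left end outside [q.1 :&: r.1] has its right end in one of the
    covers. With the mirrored [bicover_uncrossC] this yields two covers of total size |q| + |r|. *)
Lemma bicover_uncross {A B : finType} {E F : {set A * B}} {q r : {set A} * {set B}} :
  bicover E q -> bicover F r ->
  bicover (E :&: F) (q.1 :&: r.1, q.2 :|: r.2).
Proof.
move=> /bicoverP qE /bicoverP rF; apply/bicoverP => a b /=.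
rewrite !inE => /andP[/qE abq /rF abr].
by case: abq => ->; case: abr => ->; rewrite ?orbT; auto.
Qed.

Definition swap_edges (A B : finType) (E : {set A * B}) : {set B * A} :=
  [set p | (p.2, p.1) \in E].

Lemma bicover_swap (A B : finType) (E : {set A * B}) (q : {set B} * {set A}) :
  bicover (swap_edges E) q = bicover E (q.2, q.1).
Proof.
apply/bicoverP/bicoverP => h a b abE.
  by apply/or_comm/h; rewrite inE.
by apply/or_comm/h; rewrite inE in abE.
Qed.

Lemma bicover_uncrossC {A B : finType} {E F : {set A * B}} {q r : {set A} * {set B}} :
  bicover E q -> bicover F r ->
  bicover (E :&: F) (q.1 :|: r.1, q.2 :&: r.2).
Proof.
move=> /bicoverP qE /bicoverP rF; apply/bicoverP => a b /=.
rewrite !inE => /andP[/qE abq /rF abr].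
by case: abq => ->; case: abr => ->; rewrite ?orbT; auto.
Qed.

Definition cover_geq (A B : finType) k (E : {set A * B}) :=
  [forall q : {set A} * {set B}, bicover E q ==> (k <= #|q.1| + #|q.2|)].

Lemma cover_geqP {A B : finType} {k} {E : {set A * B}} :
  reflect (forall q : {set A} * {set B}, bicover E q -> k <= #|q.1| + #|q.2|) (cover_geq k E).
Proof. exact: 'forall_implyP. Qed.

Lemma cover_geqPn {A B : finType} {k} {E : {set A * B}} :
  reflect (exists2 q : {set A} * {set B}, bicover E q & #|q.1| + #|q.2| < k) (~~ cover_geq k E).
Proof.
rewrite negb_forall; apply: (iffP existsP) => -[q]; rewrite ?negb_imply -?ltnNge.
  by case/andP; exists q.
by move=> qE qk; exists q; rewrite negb_imply -ltnNge qE.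
Qed.

Lemma cover_geq_swap (A B : finType) k (E : {set A * B}) :
  cover_geq k (swap_edges E) = cover_geq k E.
Proof.
apply/cover_geqP/cover_geqP => h q qE; rewrite addnC.
  by apply: (h (q.2, q.1)); rewrite bicover_swap -surjective_pairing.
by apply: (h (q.2, q.1)); rewrite -bicover_swap.
Qed.

(* Two critical edges xy and xz would give covers q of E - xy and r of E - xz
   of size less than k; uncrossing them yields covers of E, after adding x to
   one of them, of total size |q| + |r| + 1 < 2k. *)
Lemma minimal_cover_geq_fst_inj (A B : finType) k (E : {set A * B}) :
  cover_geq k E -> (forall e, e \in E -> ~~ cover_geq k (E :\ e)) ->
  {in E &, injective fst}.
Proof.
move=> /cover_geqP kE minE [x y] [x' z] eE fE /= exx'; rewrite -{}exx' in fE *.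
apply: contraTeq isT => neq_ef.
have /cover_geqPn[q qE qk] := minE _ eE; have /cover_geqPn[r rE rk] := minE _ fE.
have uncrossed := bicover_uncross qE rE.
have swapped := bicover_uncrossC qE rE.
have edgeD a b e f : (a, b) \in E -> (a, b) != e -> (a, b) != f ->
    (a, b) \in (E :\ e) :&: (E :\ f).
  by move=> abE abe abf; rewrite !inE abe abf abE.
(* With x in it, [q] would also cover xy, hence all of [E], with fewer than k vertices. *)
have xq : x \notin q.1.
  apply: contraTN qk => xq; rewrite -leqNgt; apply: kE.
  apply/bicoverP => a b abE; case: (eqVneq (a, b) (x, y)) => [[-> _]|abe]; first by left.
  by move/bicoverP: qE; apply; rewrite !inE abe.
have xr : x \notin r.1.
  apply: contraTN rk => xr; rewrite -leqNgt; apply: kE.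
  apply/bicoverP => a b abE; case: (eqVneq (a, b) (x, z)) => [[-> _]|abe]; first by left.
  by move/bicoverP: rE; apply; rewrite !inE abe.
have zq : z \in q.2.
  have /bicoverP/(_ x z) := qE; rewrite !inE (negPf xq) eq_sym neq_ef fE.
  by case=> // /(_ isT).
have yr : y \in r.2.
  have /bicoverP/(_ x y) := rE; rewrite !inE (negPf xr) neq_ef eE.
  by case=> // /(_ isT).
have h1 : bicover E (q.1 :&: r.1, q.2 :|: r.2).
  apply/bicoverP => a b abE; rewrite /=.
  case: (eqVneq (a, b) (x, y)) => [[_ ->]|abe]; first by right; rewrite inE yr orbT.
  case: (eqVneq (a, b) (x, z)) => [[_ ->]|abf]; first by right; rewrite inE zq.
  exact: (bicoverP uncrossed) (edgeD _ _ _ _ abE abe abf).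
have h2 : bicover E (x |: (q.1 :|: r.1), q.2 :&: r.2).
  apply/bicoverP => a b abE; rewrite /= in_setU1.
  case: (eqVneq a x) => [_|ax]; first by left.
  by apply: (bicoverP swapped); apply: edgeD => //; apply: contraNneq ax => -[->].
have := kE _ h1; have := kE _ h2; rewrite /= cardsU1.
have := cardsUI q.1 r.1; have := cardsUI q.2 r.2.
by case: (x \notin _) => /=; lia.
Qed.

(** A subgraph minimal among those needing k cover vertices is already a matching, since critical
    edges share no end on either side. Its left ends cover it, so it has at least k edges, and any k
    of them serve. *)
Lemma konig (A B : finType) (E : {set A * B}) k :
  (forall q : {set A} * {set B}, bicover E q -> k <= #|q.1| + #|q.2|) ->
  exists2 N : {set A * B}, N \subset E &
    [/\ {in N &, injective fst}, {in N &, injective snd} & #|N| = k].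
Proof.
move=> /cover_geqP kE.
have [F /minsetP[kF minF] sFE] := @minset_exists _ (cover_geq k) E kE.
have critF e : e \in F -> ~~ cover_geq k (F :\ e).
  move=> eF; apply/negP => /minF/(_ (subsetDl _ _)) eqF.
  by move: eF; rewrite -eqF !inE eqxx.
have fst_inj : {in F &, injective fst} by apply: (minimal_cover_geq_fst_inj kF).
have snd_inj : {in F &, injective snd}.
  have swap_inj : {in swap_edges F &, injective fst}.
    apply: (@minimal_cover_geq_fst_inj _ _ k); rewrite ?cover_geq_swap //.
    move=> [b a]; rewrite inE /= => abF.
    have -> : swap_edges F :\ (b, a) = swap_edges (F :\ (a, b)).
      by apply/setP => -[b' a']; rewrite !inE /= !xpair_eqE [(b' == b) && _]andbC.
    by rewrite cover_geq_swap critF.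
  move=> [a b] [a' b'] abF abF' /= ebb'.
  have := swap_inj (b, a) (b', a'); rewrite !inE /=.
  by move=> /(_ abF abF' ebb') [-> ->].
have leF : k <= #|F|.
  rewrite -(card_in_imset fst_inj) -[leqRHS]addn0 -(cards0 B).
  apply: (cover_geqP kF (_, _)); apply/bicoverP => a b abF.
  by left; apply/imsetP; exists (a, b).
have [N [sNF sizeN]] : exists N : {set A * B}, N \subset F /\ #|N| = k.
  have /card_gt0P[N] : 0 < #|[set N : {set A * B} | (N \subset F) && (#|N| == k)]|.
    by rewrite cards_draws bin_gt0.
  by rewrite inE => /andP[sNF /eqP]; exists N.
exists N; first exact: subset_trans sFE.
split=> // e f eN fN; first by apply: fst_inj; apply: (subsetP sNF).
by apply: snd_inj; apply: (subsetP sNF).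
Qed.

(** * Matchings across a cut *)

Section Cuts.

Context {m : nat} (c : edge m -> bool).

(** Totalised by [false] off the edges, so that a cut is a bipartite graph on pairs of ordinals.
    Pairs in [cut_edges] are increasing, so there it agrees with [c]. *)
Definition edge_color (p : 'I_m * 'I_m) : bool := oapp c false (insub p).

Definition cut_edges (t : nat) (k : bool) : {set 'I_m * 'I_m} :=
  [set p : 'I_m * 'I_m | (p.1 < t <= p.2) && (edge_color p == k)].

Definition before (t : nat) : {set 'I_m} := [set i : 'I_m | i < t].

Lemma card_before t : t <= m -> #|before t| = t.
Proof.
move=> le_tm; have widen_inj : injective (widen_ord le_tm).
  by move=> i j /(congr1 val) /= /val_inj.
rewrite -[RHS]card_ord -(card_imset _ widen_inj).
apply: eq_card => i; rewrite inE; apply/idP/imsetP => [lt_it | [j _ ->] /=].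
  by exists (Ordinal lt_it) => //; apply: val_inj.
exact: ltn_ord.
Qed.

(** All sources lie before t and all targets at or after t, so no source is a target and no edge
    ends before another starts. Injectivity keeps sources apart, and likewise targets. *)
Lemma cut_matching t k (N : {set 'I_m * 'I_m}) :
  N \subset cut_edges t k -> {in N &, injective fst} -> {in N &, injective snd} ->
  exists M : {set edge m},
    [/\ matching M, non_separated M, monochromatic c M & #|M| = #|N|].
Proof.
move=> /subsetP sN fst_inj snd_inj; pose M := [set e : edge m | val e \in N].
have cutM e : e \in M -> src e < t <= tgt e.
  by rewrite inE => /sN; rewrite inE => /andP[].
exists M; split.
- move=> e f eM fM neq_ef; have := cutM _ eM; have := cutM _ fM.
  move=> /andP[sf tf] /andP[se te].
  have neq_sf : src e != src f.
    apply: contraNneq neq_ef => /fst_inj eq_ef; apply/eqP/val_inj/eq_ef.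
      by rewrite inE in eM.
    by rewrite inE in fM.
  have neq_tf : tgt e != tgt f.
    apply: contraNneq neq_ef => /snd_inj eq_ef; apply/eqP/val_inj/eq_ef.
      by rewrite inE in eM.
    by rewrite inE in fM.
  have neq_st : src e != tgt f by rewrite -val_eqE neq_ltn (leq_trans se).
  have neq_ts : src f != tgt e by rewrite -val_eqE neq_ltn (leq_trans sf).
  rewrite /independent /ends -setI_eq0; apply/eqP/setP => i; rewrite !inE.
  apply/negP => /andP[/orP[]/eqP-> /orP[]/eqP eq_i].
  + by rewrite eq_i eqxx in neq_sf.
  + by rewrite eq_i eqxx in neq_st.
  + by rewrite eq_i eqxx in neq_ts.
  + by rewrite eq_i eqxx in neq_tf.
- move=> e f /cutM/andP[se te] /cutM/andP[sf tf]; rewrite /separated.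
  by apply/negP => /orP[]/and3P[]; lia.
- exists k => e; rewrite inE => /sN; rewrite inE => /andP[_ /eqP].
  by rewrite /edge_color valK.
- rewrite -(card_imset _ val_inj); apply: eq_card => p.
  apply/imsetP/idP => [[e + ->]|pN]; first by rewrite inE.
  have lt_p : p.1 < p.2.
    by have := sN _ pN; rewrite inE => /andP[/andP[lt1 le2] _]; apply: leq_trans le2.
  by exists (Sub p lt_p : edge m); rewrite ?inE SubK.
Qed.

End Cuts.

(** * Small covers at all cuts are contradictory *)

Lemma cut_covers_absurd m n (c : edge m -> bool)
    (q : nat -> bool -> {set 'I_m} * {set 'I_m}) :
  0 < n -> 3 * n <= m.+1 ->
  (forall t k, t <= m -> bicover (cut_edges c t k) (q t k)) ->
  (forall t k, #|(q t k).1| + #|(q t k).2| < n) -> False.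
Proof.
move=> n_gt0 le_nm qE q_lt.
pose X t k := (q t k).1; pose Y t k := (q t k).2.
have qX t k : #|X t k| + #|Y t k| < n by apply: q_lt.
have qcover t (d e : 'I_m) : t <= m -> d < t <= e ->
    d \in X t (edge_color c (d, e)) \/ e \in Y t (edge_color c (d, e)).
  by move=> tm de; apply: (bicoverP (qE t _ tm)); rewrite inE de eqxx.
pose L := @before m; pose covL t := L t \subset X t true :|: X t false.
(* A left vertex d in neither X forces each right vertex e into the Y of the color of de. *)
have covR t : t <= m -> ~~ covL t -> ~: L t \subset Y t true :|: Y t false.
  move=> tm /subsetPn[d]; rewrite !inE negb_or => dL /andP[dX1 dX0].
  apply/subsetP => e; rewrite !inE -leqNgt => eR.
  have := qcover t d e tm; rewrite dL eR => /(_ isT).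
  by case: edge_color; rewrite ?(negPf dX1) ?(negPf dX0) => -[]// ->; rewrite ?orbT.
have sumX t := cardsUI (X t true) (X t false).
have sumY t := cardsUI (Y t true) (Y t false).
have cardL t : t <= m -> #|L t| = t by apply: card_before.
have cardR t : t <= m -> #|~: L t| = m - t.
  by move=> tm; have := cardsC (L t); rewrite card_ord cardL //; lia.
have covL_lt t : covL t -> t <= m -> t <= 2 * n - 2.
  move=> /subset_leq_card + tm; rewrite cardL //.
  by have := sumX t; have := qX t true; have := qX t false; lia.
have exL : exists t, covL t && (t <= m).
  by exists 0; rewrite leq0n andbT; apply/subsetP => i; rewrite inE.
have ubL t : covL t && (t <= m) -> t <= m by case/andP.
have [t /andP[covt le_tm] max_t] := ex_maxnP exL ubL.
have t_lt := covL_lt t covt le_tm.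
have St_le : t.+1 <= m by lia.
have /(covR _ St_le) covSt : ~~ covL t.+1.
  by apply/negP => covSt; have := max_t t.+1; rewrite covSt St_le ltnn => /(_ isT).
(* As [L t] is covered at t, each d in [D] lies in exactly one [X t j], and in no [X t.+1 j].
   Dually, each e in [C] lies in exactly one [Y t.+1 j], and in no [Y t j]. *)
pose D := (L t :\: (X t.+1 true :|: X t.+1 false)) :\: (X t true :&: X t false).
pose C := (~: L t.+1 :\: (Y t true :|: Y t false)) :\: (Y t.+1 true :&: Y t.+1 false).
have card_diff (T : finType) (S U : {set T}) : #|S| <= #|S :\: U| + #|U|.
  by rewrite -(cardsID U S) addnC leq_add2l subset_leq_card // subsetIr.
have Dge : t <= #|D| + #|X t.+1 true :|: X t.+1 false| + #|X t true :&: X t false|.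
  have := card_diff _ (L t) (X t.+1 true :|: X t.+1 false); rewrite cardL //.
  have := card_diff _ (L t :\: (X t.+1 true :|: X t.+1 false)) (X t true :&: X t false).
  by rewrite -/D; lia.
have Cge : m - t.+1 <=
    #|C| + #|Y t true :|: Y t false| + #|Y t.+1 true :&: Y t.+1 false|.
  have := card_diff _ (~: L t.+1) (Y t true :|: Y t false); rewrite cardR //.
  have := card_diff _ (~: L t.+1 :\: (Y t true :|: Y t false))
    (Y t.+1 true :&: Y t.+1 false).
  by rewrite -/C; lia.
have := subset_leq_card covt; have := subset_leq_card covSt.
rewrite cardL // cardR // => Yge Xge.
move: (sumX t) (sumX t.+1) (sumY t) (sumY t.+1) => sX sX' sY sY'.
move: (qX t true) (qX t false) (qX t.+1 true) (qX t.+1 false) => q1 q0 q1' q0'.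
(* Since |X1 :&: X0| <= |X1| + |X0| - t at t, and similarly for Y at t + 1, the sum is at least 2(m
   - 1) minus the sizes of four covers, so at least 2(3n - 2) - 4(n - 1) = 2n. *)
have DCge : 2 * n <= #|D| + #|C| by lia.
(* A separate count: the covers spend at least t vertices on the left at t and m - t - 1 on the
   right at t + 1. With both t and m - t - 1 at most 2n - 2, each of [D] and [C] has at least 2m + 4
   - 6n >= 2 elements. *)
have /card_gt0P[d0 d0D] : 0 < #|D| by lia.
have /card_gt0P[e0 e0C] : 0 < #|C| by lia.
(* At t the edge de must be covered by d, at t + 1 by e. So its color is the unique j with d in
   [X t j], and the unique j with e in [Y t.+1 j]. *)
have DC (d e : 'I_m) : d \in D -> e \in C -> let k := edge_color c (d, e) in
    (d \in X t k) && (d \notin X t (~~ k)) &&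
    (e \in Y t.+1 k) && (e \notin Y t.+1 (~~ k)).
  rewrite !inE -leqNgt !negb_and !negb_or.
  move=> /and3P[dX /andP[dX1' dX0'] dt] /and3P[eY' /andP[eY1 eY0] et].
  have := qcover t d e le_tm; rewrite dt (ltnW et) => /(_ isT).
  have := qcover t.+1 d e St_le; rewrite et (ltn_trans dt) // => /(_ isT).
  case: edge_color => /=; rewrite ?(negPf dX1') ?(negPf dX0') ?(negPf eY1) ?(negPf eY0).
    by case=> // eY1'; case=> // dX1; move: dX eY'; rewrite dX1 eY1' /= => -> ->.
  by case=> // eY0'; case=> // dX0; move: dX eY'; rewrite dX0 eY0' /= !orbF => -> ->.
pose k := edge_color c (d0, e0).
have /andP[/andP[/andP[d0X d0X'] e0Y] e0Y'] := DC _ _ d0D e0C.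
(* The end [e0] alone determines the color of (d, e0), which is therefore k; for [subC] the end [d0]
   does the same. *)
have subD : D \subset X t k.
  apply/subsetP => d dD; have /andP[/andP[/andP[dX _] eY] _] := DC _ _ dD e0C.
  suff -> : k = edge_color c (d, e0) by [].
  by apply: contraNeq e0Y'; rewrite negb_eqb => /addbP->.
have subC : C \subset Y t.+1 k.
  apply/subsetP => e eC; have /andP[/andP[/andP[dX _] eY] _] := DC _ _ d0D eC.
  suff -> : k = edge_color c (d0, e) by [].
  by apply: contraNeq d0X'; rewrite negb_eqb => /addbP->.
have := subset_leq_card subD; have := subset_leq_card subC.
by have := qX t k; have := qX t.+1 k; lia.
Qed.

Theorem theorem2p15 (n : nat) (hn : 1 <= n) (c : edge (3 * n - 1) -> bool) :
  exists M : {set edge (3 * n - 1)},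
    [/\ matching M, non_separated M, monochromatic c M & #|M| = n].
Proof.
have [/existsP[t /existsP[k kE]] | noE] :=
    boolP [exists t : 'I_(3 * n - 1).+1, exists k, cover_geq n (cut_edges c t k)].
  have [N sN [fst_inj snd_inj cardN]] := konig (cover_geqP kE).
  by have [M] := cut_matching sN fst_inj snd_inj; rewrite cardN; exists M.
pose small t k q := bicover (cut_edges c t k) q && (#|q.1| + #|q.2| < n).
(* The empty default keeps the size bound valid for every t, as n > 0. For t <= m a small cover
   exists and is picked. *)
pose q t k := odflt (set0, set0) [pick q | small t k q].
case: (@cut_covers_absurd _ n c q hn) => [|t k le_t | t k]; first by lia.
  rewrite /q; case: pickP => [q' /andP[] // | no_q].
  case/negP: noE; apply/existsP; exists (Ordinal (le_t : t < (3 * n - 1).+1)).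
  apply/existsP; exists k; apply/cover_geqP => q' q'E.
  by have := no_q q'; rewrite /small q'E /= ltnNge => /negbFE.
by rewrite /q; case: pickP => [q' /andP[] // | _] /=; rewrite !cards0.
Qed.
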